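(* Let $\mathcal M=(N,\mathcal I)$ be a loopless matroid with rank function $r$ that contains $3h$ pairwise disjoint bases for some integer $h\ge1$, and let $S\subseteq N$ be a random set containing each element independently with probability $1/2$. Then $$\Pr\Big[|\mathrm{span}(D(S,h))\setminus S|\le \tfrac{|N|}{12}\Big]\le\exp\Big(-\tfrac{|N|}{144}\Big)\quad\text{and}\quad \Pr\Big[r(D(S,h))\le\tfrac{r(N)}{8}\Big]\le\exp\Big(-\tfrac{r(N)}{48}\Big).$$
   Context: $D(S,\lambda)=D_{\mathcal M}(S,\lambda)$ is the unique inclusion-wise maximal set among the maximizers of $|U|-\lambda r(U)$ over $U\subseteq S$. $\mathrm{span}(A)=\{e\in N: r(A\cup\{e\})=r(A)\}$. *)

(* Defs.v *)
From mathcomp Require Import all_boot all_order all_algebra.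
Set Implicit Arguments. Unset Strict Implicit. Unset Printing Implicit Defensive.
Import Order.TTheory GRing.Theory Num.Theory.

Section Matroid.
Variable T : finType.
Variable I : pred {set T}.

Definition is_matroid : Prop :=
  [/\ I set0,
      (forall A B : {set T}, A \subset B -> I B -> I A) &
      (forall A B : {set T}, I A -> I B -> #|A| < #|B| ->
          exists2 x, x \in B :\: A & I (x |: A))].

Definition mrank (A : {set T}) : nat :=
  \max_(B : {set T} | (B \subset A) && I B) #|B|.

Definition loopless : Prop := forall x : T, I [set x].

Definition is_basis (B : {set T}) : Prop :=
  I B /\ (forall x, x \notin B -> ~~ I (x |: B)).

Definition mspan (A : {set T}) : {set T} :=
  [set e | mrank (e |: A) == mrank A].

Definition Dobj (lam : nat) (U : {set T}) : int :=
  (#|U|%:Z - (lam * mrank U)%:Z)%R.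

Definition is_Dmaximizer (S : {set T}) (lam : nat) (U : {set T}) : bool :=
  (U \subset S) &&
  [forall V : {set T}, (V \subset S) ==> (Dobj lam V <= Dobj lam U)%R].

(* D(S, lam): the (unique) inclusion-wise maximal maximizer, i.e. the
   maximizer containing every maximizer (set0 if none exists, which
   does not happen). *)
Definition Dmax (S : {set T}) (lam : nat) : {set T} :=
  odflt set0 [pick U | is_Dmaximizer S lam U &&
     [forall V, is_Dmaximizer S lam V ==> (V \subset U)]].

End Matroid.

From mathcomp Require Import reals.

(* Probability that a uniformly random subset S of T (each element
   independently with probability 1/2) satisfies P. *)
Definition prob_half {R : realType} (T : finType) (P : pred {set T}) : R :=
  (#|[set S : {set T} | P S]|%:R / (2 ^ #|T|)%:R)%R.

(* Main.v *)
Require Import Defs.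
From mathcomp Require Import all_boot all_order all_algebra.
From mathcomp Require Import reals.
From mathcomp.analysis Require Import sequences exp.
From mathcomp Require Import zify ring lra.
Import Order.TTheory GRing.Theory Num.Theory.
Local Open Scope ring_scope.
Set Implicit Arguments. Unset Strict Implicit. Unset Printing Implicit Defensive.

(** Write f(S) for the maximum of |U| - h r(U) over U included in S, and scan
    the elements e of a ground set E with |E| >= 3 h r(E) in a fixed order,
    S_e being the part of S \cap E before e.  Inserting e into S_e raises f by
    at most one, and only if e lies in span(D(S_e)); call such an e hot.  Hence
    |S \cap E| - h r(E) <= f(S \cap E) is at most the number of hot elements of
    S, i.e. at most |E|/3 elements of S are not hot, while the hot elements
    outside S all lie in span(D(S)) \ S.  Whether e is hot only depends on S_e,
    so flipping the membership of the hot elements is a bijection on subsets,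
    and if |span(D(S)) \ S| <= |E|/12 it sends S to a set meeting E in at most
    5|E|/12 elements.  A Chernoff bound concludes.  The first estimate is the
    case E = N; the second is the case where E is the union of the 3h bases,
    since then |span(D) \ S| <= 3h r(D) - |D| <= 2h r(D). *)

(** * Rank and span in a matroid *)

Section Rank.
Variables (T : finType) (I : pred {set T}).
Hypothesis matI : is_matroid I.
Implicit Types A B J : {set T}.
Local Notation r := (mrank I).

Lemma indep_leq_mrank A J : J \subset A -> I J -> (#|J| <= r A)%N.
Proof.
by move=> sJA IJ; rewrite /mrank (bigop.bigmax_sup J) // sJA.
Qed.

Lemma mrank_leqP A k :
  (forall J, J \subset A -> I J -> (#|J| <= k)%N) -> (r A <= k)%N.
Proof. by move=> H; apply/bigmax_leqP => J /andP[]; apply: H. Qed.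

Lemma mrankS A B : A \subset B -> (r A <= r B)%N.
Proof.
move=> sAB; apply: mrank_leqP => J sJA.
by apply: indep_leq_mrank; apply: subset_trans sAB.
Qed.

Lemma mrank_basis A : exists J : {set T}, [/\ J \subset A, I J & #|J| = r A].
Proof.
have [I0 _ _] := matI.
have P_gt0 : (0 < #|[pred B : {set T} | (B \subset A) && I B]|)%N.
  by apply/card_gt0P; exists set0; rewrite inE sub0set.
have [J + cJ] := eq_bigmax_cond (fun B : {set T} => #|B|) P_gt0.
by rewrite inE => /andP[sJA IJ]; exists J.
Qed.

Lemma indep_extend A J : J \subset A -> I J ->
  exists K : {set T}, [/\ J \subset K, K \subset A, I K & #|K| = r A].
Proof.
have [_ _ aug] := matI.
move=> sJA IJ.
have [K /maxsetP[/andP[sKA IK] Kmax] sJK] :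
    {K | maxset (fun K : {set T} => (K \subset A) && I K) K & J \subset K}.
  by apply: maxset_exists; rewrite sJA IJ.
exists K; split=> //.
apply/eqP; rewrite eqn_leq indep_leq_mrank //= leqNgt; apply/negP => ltK.
have [B [sBA IB cB]] := mrank_basis A; rewrite -cB in ltK.
have [x] := aug K B IK IB ltK; rewrite inE => /andP[xK xB] IxK.
have := Kmax (x |: K); rewrite IxK subUset sub1set (subsetP sBA) // sKA.
by move=> /(_ isT (subsetUr _ _)) xKK; rewrite -xKK setU11 in xK.
Qed.

(** Extend a maximal independent subset J of A ∩ B to one, K, of A ∪ B: both K ∩ A and K ∩ B are
    independent, and their intersection contains J. *)
Lemma mrank_submod A B : (r (A :|: B) + r (A :&: B) <= r A + r B)%N.
Proof.
have [_ hered _] := matI.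
have [J [sJ IJ cJ]] := mrank_basis (A :&: B).
have [K [sJK sK IK cK]] :
    exists K : {set T}, [/\ J \subset K, K \subset A :|: B, I K & #|K| = r (A :|: B)].
  apply: indep_extend => //; apply: subset_trans sJ _.
  exact: subset_trans (subsetIl _ _) (subsetUl _ _).
have KA : (#|K :&: A| <= r A)%N.
  by apply: indep_leq_mrank; rewrite ?subsetIr //; apply: hered IK; exact: subsetIl.
have KB : (#|K :&: B| <= r B)%N.
  by apply: indep_leq_mrank; rewrite ?subsetIr //; apply: hered IK; exact: subsetIl.
apply: leq_trans (leq_add KA KB).
rewrite -cardsUI -setIUr -setIIr (setIidPl sK) cK leq_add2l -cJ.
by apply: subset_leq_card; rewrite subsetI sJK.
Qed.

Lemma subset_mspan A : A \subset mspan I A.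
Proof. by apply/subsetP => x xA; rewrite inE (setUidPr _) // sub1set. Qed.

Lemma mspanS A B : A \subset B -> mspan I A \subset mspan I B.
Proof.
move=> sAB; apply/subsetP => e; rewrite !inE => /eqP eA.
rewrite eqn_leq [X in _ && X]mrankS ?subsetUr // andbT.
have := mrank_submod (e |: A) B.
have -> : (e |: A) :|: B = e |: B by rewrite -setUA (setUidPr sAB).
have : (r A <= r ((e |: A) :&: B))%N by apply: mrankS; rewrite subsetI subsetUr.
rewrite eA; lia.
Qed.

(** Otherwise a maximal independent K in A could be augmented by some x of J, and K + x would exceed
    the rank of A + x, which equals that of A. *)
Lemma indep_mspan A J : J \subset mspan I A -> I J -> (#|J| <= r A)%N.
Proof.
have [_ _ aug] := matI.
move=> sJ IJ; have [K [sKA IK cK]] := mrank_basis A.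
rewrite leqNgt -cK; apply/negP => ltJ.
have [x] := aug K J IK IJ ltJ; rewrite inE => /andP[xK xJ] IxK.
have := subsetP sJ x xJ; rewrite inE => /eqP eqr.
have : (#|x |: K| <= r (x |: A))%N by apply: indep_leq_mrank => //; exact: setUS.
by rewrite eqr cardsU1 xK cK add1n ltnn.
Qed.

Lemma card_is_basis B : is_basis I B -> #|B| = r [set: T].
Proof.
have [_ _ aug] := matI.
move=> [IB maxB]; apply/eqP; rewrite eqn_leq indep_leq_mrank ?subsetT //=.
have [K [_ IK cK]] := mrank_basis [set: T].
rewrite -cK leqNgt; apply/negP => ltB.
have [x] := aug B K IB IK ltB; rewrite inE => /andP[xB _] IxB.
by have := maxB x xB; rewrite IxB.
Qed.

End Rank.

(** * Existence and monotonicity of D(S, h) *)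

Section DensestSet.
Variables (T : finType) (I : pred {set T}) (h : nat).
Hypothesis matI : is_matroid I.
Implicit Types S U V : {set T}.
Local Notation r := (mrank I).
Local Notation f := (Dobj I h).
Local Notation D := (fun S => Dmax I S h).

Lemma Dobj_supermod U V : f U + f V <= f (U :|: V) + f (U :&: V).
Proof.
have := cardsUI U V; have := mrank_submod matI U V.
by move=> /(leq_mul (leqnn h)); rewrite /Dobj !mulnDr; lia.
Qed.

Lemma is_DmaximizerP S U :
  reflect (U \subset S /\ forall V, V \subset S -> f V <= f U)
          (is_Dmaximizer I S h U).
Proof.
apply: (iffP andP) => -[sU H]; split=> //.
  by move=> V; apply/implyP; move/forallP: H; apply.
by apply/forallP => V; apply/implyP; apply: H.
Qed.

Lemma is_DmaximizerU S U V :
  is_Dmaximizer I S h U -> is_Dmaximizer I S h V ->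
  is_Dmaximizer I S h (U :|: V).
Proof.
move=> /is_DmaximizerP[sU mU] /is_DmaximizerP[sV mV].
apply/is_DmaximizerP; split=> [|W sW]; first by rewrite subUset sU.
have := Dobj_supermod U V; have := mV (U :&: V) (subset_trans (subsetIr _ _) sV).
have := mU W sW; lia.
Qed.

(** Maximizers are closed under union, so an inclusion-maximal one contains all the others and the
    default [set0] in [Dmax] is never reached. *)
Lemma DmaxP S : is_Dmaximizer I S h (D S) /\
  forall V, is_Dmaximizer I S h V -> V \subset D S.
Proof.
rewrite /Dmax; case: pickP => [U /andP[mU /forallP maxU] | none] /=.
  by split=> // V; apply/implyP.
have [U0 mU0] : exists U, is_Dmaximizer I S h U.
  case: (@arg_maxP _ int {set T} set0 (fun U => U \subset S) f) => [|U sU mU].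
    exact: sub0set.
  by exists U; apply/is_DmaximizerP; split.
have [U /maxsetP[mU Umax] _] := maxset_exists mU0.
have /negP[] := negbT (none U); rewrite mU /=; apply/forallP => V.
apply/implyP => mV; rewrite -(Umax _ (is_DmaximizerU mU mV) (subsetUl _ _)).
exact: subsetUr.
Qed.

Lemma Dmax_sub S : D S \subset S.
Proof. by have [/is_DmaximizerP[]] := DmaxP S. Qed.

Lemma Dmax_max S U : U \subset S -> f U <= f (D S).
Proof. by have [/is_DmaximizerP[_ +] _] := DmaxP S; apply. Qed.

Lemma sub_Dmax S U : U \subset S -> f (D S) <= f U -> U \subset D S.
Proof.
move=> sU leU; have [_ maxD] := DmaxP S; apply: maxD; apply/is_DmaximizerP.
by split=> // V /Dmax_max /le_trans; apply.
Qed.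

Lemma Dobj0 : f set0 = 0.
Proof.
have r0 : r set0 = 0%N.
  apply/eqP; rewrite -leqn0; apply: mrank_leqP => J; rewrite subset0 => /eqP -> _.
  by rewrite cards0.
by rewrite /Dobj r0 cards0 muln0.
Qed.

Lemma Dmax_ge0 S : 0 <= f (D S).
Proof. by rewrite -Dobj0 Dmax_max // sub0set. Qed.

(** Since D(S) ∩ D(S') lies in S, its value is at most f(D(S)); supermodularity then makes D(S) ∪
    D(S') a maximizer for S'. *)
Lemma DmaxS S S' : S \subset S' -> D S \subset D S'.
Proof.
move=> sS; apply: subset_trans (subsetUl _ (D S')) _; apply: sub_Dmax.
  by rewrite subUset Dmax_sub andbT; apply: subset_trans sS; exact: Dmax_sub.
have := Dobj_supermod (D S) (D S').
have : f (D S :&: D S') <= f (D S).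
  by apply: Dmax_max; apply: subset_trans (Dmax_sub S); exact: subsetIl.
lia.
Qed.

(** * Hot elements and the flipping bijection *)

Hypothesis h_gt0 : (0 < h)%N.

(** Removing e from D(S + e) leaves U inside S and costs at most one. If e is outside span(D(S)),
    either the rank drops too, saving h >= 1, or e lies in span(U); then U is not a maximizer for S,
    as U inside D(S) would put e in span(D(S)), so f(U) < f(D(S)). *)
Lemma Dmax_step S e : e \notin S ->
  f (D (e |: S)) <= f (D S) + (e \in mspan I (D S))%:Z.
Proof.
move=> eS; have sD := Dmax_sub (e |: S); set D' := D (e |: S) in sD *.
have [eD'|eD'] := boolP (e \in D'); last first.
  have : f D' <= f (D S).
    by apply: Dmax_max; rewrite -(setU1K eS) subsetD1 sD.
  lia.
set U := D' :\ e.
have sU : U \subset S by rewrite subDset.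
have fU := Dmax_max sU.
have cD : #|D'| = #|U|.+1 by rewrite (cardsD1 e) eD'.
have rU : (r U <= r D')%N by apply: mrankS; exact: subD1set.
have := leq_mul (leqnn h) rU.
have [_|eN] := boolP (e \in mspan I (D S)); first by move: fU; rewrite /Dobj cD; lia.
move=> _; move: rU; rewrite leq_eqVlt => /orP[/eqP eqr|ltr]; last first.
  by have := leq_mul (leqnn h) ltr; move: fU; rewrite /Dobj cD mulnS; lia.
have eU : e \in mspan I U by rewrite inE setD1K // eqr.
have [leU|] := lerP (f (D S)) (f U); last by rewrite /Dobj cD eqr; lia.
by have := subsetP (mspanS matI (sub_Dmax sU leU)) e eU; rewrite (negPf eN).
Qed.

(** The scanning order is [enum_rank]. The strict inequality keeps e out of its own prefix, so being
    hot does not depend on whether e is in S. *)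
Definition prefix_set S (i : nat) : {set T} := [set e in S | (enum_rank e < i)%N].

Definition hot S : {set T} :=
  [set e | e \in mspan I (D (prefix_set S (enum_rank e)))].

Lemma prefix_set_sub S i : prefix_set S i \subset S.
Proof. by apply/subsetP => e; rewrite inE => /andP[]. Qed.

Lemma hot_sub S : hot S \subset mspan I (D S).
Proof.
apply/subsetP => e; rewrite inE; apply/subsetP; apply: mspanS => //.
exact/DmaxS/prefix_set_sub.
Qed.

Lemma Dobj_prefix_leq S i : (i <= #|T|)%N ->
  f (D (prefix_set S i)) <= #|prefix_set S i :&: hot S|%:Z.
Proof.
elim: i => [_|i IHi lti].
  have -> : prefix_set S 0 = set0 by apply/setP => e; rewrite !inE andbF.
  by have := Dmax_sub set0; rewrite subset0 => /eqP ->; rewrite Dobj0.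
have {}IHi := IHi (ltnW lti).
pose e := enum_val (Ordinal lti).
have re : enum_rank e = Ordinal lti by rewrite enum_valK.
have rE x : (enum_rank x < i.+1)%N = (x == e) || (enum_rank x < i)%N.
  rewrite ltnS leq_eqVlt; congr (_ || _).
  by rewrite -(inj_eq enum_rank_inj) re -val_eqE.
have [eS|eS] := boolP (e \in S); last first.
  suff -> : prefix_set S i.+1 = prefix_set S i by [].
  apply/setP => x; rewrite !inE rE.
  by case: eqP => // ->; rewrite (negPf eS).
have eP : e \notin prefix_set S i by rewrite inE re ltnn andbF.
have -> : prefix_set S i.+1 = e |: prefix_set S i.
  by apply/setP => x; rewrite !inE rE; case: eqP => // ->; rewrite eS.
have := Dmax_step eP.
have -> : (e \in mspan I (D (prefix_set S i))) = (e \in hot S) by rewrite [RHS]inE re.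
rewrite setIUl; case: (boolP (e \in hot S)) => eh.
  have -> : [set e] :&: hot S = [set e] by apply/setIidPl; rewrite sub1set.
  by rewrite cardsU1 inE (negPf eP) /=; lia.
have : (#|prefix_set S i :&: hot S| <=
        #|[set e] :&: hot S :|: prefix_set S i :&: hot S|)%N.
  exact/subset_leq_card/subsetUr.
by lia.
Qed.

Lemma card_cold S : (#|S :\: hot S| <= h * r S)%N.
Proof.
have PS : prefix_set S #|T| = S.
  by apply/setP => e; rewrite inE ltn_ord andbT.
have := Dobj_prefix_leq S (leqnn _); rewrite PS.
have := Dmax_max (subxx S); rewrite /Dobj.
by have := cardsID (hot S) S; lia.
Qed.

(** Elements outside E may be flipped as well; this does not affect counts inside E. *)
Definition flip_hot (E S : {set T}) : {set T} :=
  [set e | (e \in S) (+) (e \in hot (S :&: E))].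

(** S is recovered in scanning order: its elements before e decide whether e was flipped. *)
Lemma flip_hot_inj E : injective (flip_hot E).
Proof.
move=> S S' eqf; suff H k (e : T) : (enum_rank e < k)%N -> (e \in S) = (e \in S').
  by apply/setP => e; apply: (H #|T|).
elim: k e => // k IHk e; rewrite ltnS => lek.
have /setP/(_ e) := eqf; rewrite ![_ \in flip_hot _ _]inE ![_ \in hot _]inE.
suff -> : prefix_set (S :&: E) (enum_rank e) = prefix_set (S' :&: E) (enum_rank e).
  by case: (_ \in mspan I _); case: (e \in S); case: (e \in S').
apply/setP => x; rewrite !inE; case: ltnP => [ltx|]; last by rewrite !andbF.
by rewrite (IHk x) // (leq_trans ltx).
Qed.

(** An element of E in the image is either hot and outside S, hence in the span, or in S and not
    hot, which [card_cold] bounds. *)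
Lemma card_flip_hot E S :
  (#|flip_hot E S :&: E| <= #|E :&: mspan I (D (S :&: E)) :\: S| + h * r E)%N.
Proof.
have cold := card_cold (S :&: E).
have rSE : (h * r (S :&: E) <= h * r E)%N by rewrite leq_mul // mrankS ?subsetIr.
apply: leq_trans (leq_add (leqnn _) (leq_trans cold rSE)).
apply: leq_trans (leq_card_setU _ _); apply: subset_leq_card; apply/subsetP => e.
have := subsetP (hot_sub (S :&: E)) e.
rewrite in_setI [e \in flip_hot _ _]inE in_setU !in_setD !in_setI.
case: (e \in S); case: (e \in E); case: (e \in hot _) => //= H.
by rewrite H.
Qed.

End DensestSet.

(** * Tail bound for uniformly random subsets *)

Section Chernoff.
Variables (R : realType) (T : finType).
Implicit Types (E S : {set T}).

(** Expand a product with one factor per element: 1 + x on E, and 2 off E. *)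
Lemma sum_expr_cardI E (x : R) :
  \sum_(S : {set T}) x ^+ #|S :&: E| = (1 + x) ^+ #|E| * 2 ^+ (#|T| - #|E|).
Proof.
transitivity (\prod_(i : T) ((if i \in E then x else 1) + 1)).
  rewrite bigA_distr; apply: eq_bigr => S _.
  rewrite -(big_mkcond (fun i => i \in S)) /= -big_mkcondr /= prodr_const.
  by congr (_ ^+ _); apply: eq_card => i; rewrite !inE.
rewrite (bigID (fun i => i \in E)) /=; congr (_ * _).
  by rewrite (eq_bigr (fun _ => 1 + x)) => [|i ->]; rewrite ?prodr_const // addrC.
rewrite (eq_bigr (fun _ => 2)) => [|i /negPf ->]; last by ring.
rewrite prodr_const -cardsT; congr (_ ^+ _).
by have := cardC E; rewrite cardsT => <-; rewrite addKn; apply: eq_card => i; rewrite !inE.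
Qed.

(* The tail bound is Markov's inequality for y ^+ (12 * #|S :&: E|); with
   y = 35/36, close to the optimum expR (- 1/36), the base
   (1 + y ^+ 12) / 2 / y ^+ 5 is below 143/144 <= expR (- 1/144). *)
Lemma chernoff_5_12 E :
  #|[set S : {set T} | 12 * #|S :&: E| <= 5 * #|E| ]%N|%:R
    <= 2 ^+ #|T| * expR (- (#|E|%:R / 144)) :> R.
Proof.
set A := [set S | _]; set n := #|E|; pose y : R := 35 / 36.
have y_gt0 : 0 < y by rewrite /y; lra.
have y_le1 : y <= 1 by rewrite /y; lra.
have markov : #|A|%:R * y ^+ (5 * n) <= (1 + y ^+ 12) ^+ n * 2 ^+ (#|T| - n).
  rewrite -sum_expr_cardI mulr_natl -sumr_const.
  apply: le_trans (_ : \sum_(S in A) (y ^+ 12) ^+ #|S :&: E| <= _).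
    apply: ler_sum => S; rewrite inE -exprM => leS.
    by apply: ler_wiXn2l => //; rewrite ltW.
  rewrite [leRHS](bigID (mem A)) /= lerDl; apply: sumr_ge0 => S _.
  by rewrite !exprn_ge0 // ltW.
have base : 1 + y ^+ 12 <= 2 * (143 / 144 * y ^+ 5) by rewrite /y; lra.
have exp1 : 143 / 144 <= expR (- (1 / 144)) :> R.
  by apply: le_trans (expR_ge1Dx _); lra.
have y5 : 0 < y ^+ (5 * n) by rewrite exprn_gt0.
rewrite -(ler_pM2r y5); apply: le_trans markov _.
have lenT : (n <= #|T|)%N by exact: max_card.
have -> : expR (- (n%:R / 144)) = expR (- (1 / 144)) ^+ n :> R.
  by rewrite -expRM_natl; congr expR; rewrite -mulr_natl; ring.
rewrite -{2}(subnK lenT) exprD -!mulrA [leLHS]mulrC ler_wpM2l ?exprn_ge0 //.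
rewrite exprM -!exprMn; apply: lerXn2r; rewrite ?nnegrE.
- by rewrite addr_ge0 // exprn_ge0 // ltW.
- by rewrite pmulr_rge0 // pmulr_rge0 ?expR_gt0 // exprn_ge0 // ltW.
apply: le_trans base _; by rewrite ler_pM2l // ler_pM2r // exprn_gt0.
Qed.

Lemma prob_halfS (P Q : pred {set T}) :
  (forall S, P S -> Q S) -> prob_half P <= prob_half Q :> R.
Proof.
move=> sPQ; rewrite ler_wpM2r ?invr_ge0 ?ler0n // ler_nat.
by apply/subset_leq_card/subsetP => S; rewrite !inE; apply: sPQ.
Qed.

(** The flip maps the event injectively into the sets meeting E in at most |E|/12 + |E|/3 = 5|E|/12
    elements. *)
Lemma prob_span_Dmax (I : pred {set T}) (h : nat) E :
  is_matroid I -> (0 < h)%N -> (3 * (h * mrank I E) <= #|E|)%N ->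
  prob_half (fun S : {set T} =>
      12 * #|E :&: mspan I (Dmax I (S :&: E) h) :\: S| <= #|E|)%N
    <= expR (- (#|E|%:R / 144)) :> R.
Proof.
move=> matI h_gt0 rE.
rewrite /prob_half ler_pdivrMr ?ltr0n ?expn_gt0 // natrX mulrC.
apply: le_trans (chernoff_5_12 E); rewrite ler_nat.
rewrite -(card_imset _ (@flip_hot_inj _ I h E)).
apply/subset_leq_card/subsetP => _ /imsetP[S + ->]; rewrite !inE => leS.
have := @card_flip_hot _ I h matI h_gt0 E S; lia.
Qed.

End Chernoff.

(** * The two estimates *)

Theorem theorem5p1 (R : realType) (T : finType) (I : pred {set T}) (h : nat) :
  is_matroid I -> loopless I -> (1 <= h)%N ->
  (exists Bs : 'I_(3 * h) -> {set T},
      (forall i, is_basis I (Bs i)) /\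
      (forall i j, i != j -> [disjoint Bs i & Bs j])) ->
  prob_half (R := R)
    (fun S => #|mspan I (Dmax I S h) :\: S|%:R <= #|T|%:R / 12 :> R)
    <= expR (- (#|T|%:R / 144))
  /\
  prob_half (R := R)
    (fun S => (mrank I (Dmax I S h))%:R <= (mrank I [set: T])%:R / 8 :> R)
    <= expR (- ((mrank I [set: T])%:R / 48)).
Proof.
move=> matI _ h_gt0 [Bs [basisB disjB]].
pose E := \bigcup_i Bs i.
have cardEI A : #|E :&: A| = (\sum_i #|Bs i :&: A|)%N.
  rewrite -sum1_card (eq_bigl _ _ (fun x => in_setI x _ _)) big_mkcondr /=.
  rewrite partition_disjoint_bigcup //; apply: eq_bigr => i _.
  by rewrite -big_mkcondr sum1dep_card; apply: eq_card => x; rewrite !inE.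
have cE : #|E| = (3 * (h * mrank I [set: T]))%N.
  rewrite -[E]setIT cardEI (eq_bigr (fun _ => mrank I [set: T])) => [|i _].
    by rewrite sum_nat_const card_ord mulnA.
  by rewrite setIT; apply: card_is_basis.
split.
  rewrite -[in leRHS]cardsT.
  have rT : (3 * (h * mrank I [set: T]) <= #|[set: T]|)%N.
    by rewrite -cE subset_leq_card ?subsetT.
  apply: le_trans (prob_span_Dmax R matI h_gt0 rT); apply: prob_halfS => S.
  by rewrite setTI setIT cardsT ler_pdivlMr // -natrM ler_nat mulnC.
have rE : (3 * (h * mrank I E) <= #|E|)%N.
  by rewrite cE !leq_mul // mrankS ?subsetT.
apply: le_trans (le_trans (prob_span_Dmax R matI h_gt0 rE) _).
  apply: prob_halfS => S; rewrite ler_pdivlMr // -natrM ler_nat => rD.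
  set D := Dmax I (S :&: E) h.
  have sD : D \subset S :&: E by exact: Dmax_sub.
  (* By monotonicity of D, a small rank of D(S) forces a small rank of D(S ∩ E). *)
  have rDS : (mrank I D <= mrank I (Dmax I S h))%N.
    by apply/mrankS/DmaxS => //; exact: subsetIl.
  have cD : (h * mrank I D <= #|D|)%N.
    by have := Dmax_ge0 h matI (S :&: E); rewrite /Dobj -/D; lia.
  (* Each of the 3h bases meets span(D) in an independent set, of size at most r(D). *)
  have cspan : (#|E :&: mspan I D| <= 3 * h * mrank I D)%N.
    rewrite cardEI -[X in (_ <= X * _)%N]card_ord -sum_nat_const; apply: leq_sum => i _.
    apply: indep_mspan; rewrite ?subsetIr //.
    by have [_ hered _] := matI; apply: hered (proj1 (basisB i)); exact: subsetIl.
  have split_span : (#|E :&: mspan I D :\: S| + #|D| <= #|E :&: mspan I D|)%N.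
    rewrite -(cardsID S (E :&: _)) addnC leq_add2r.
    apply/subset_leq_card/subsetP => x xD; have := subsetP sD x xD.
    by rewrite !in_setI (subsetP (subset_mspan I D)) // => /andP[-> ->].
  (* The elements of E in span(D) outside S number at most 3h r(D) - h r(D) = 2h r(D) <= h r(N)/4 =
     |E|/12. *)
  have := leq_mul (leqnn h) rDS; have := leq_mul (leqnn h) rD.
  by rewrite cE; lia.
(* Here |E|/144 = h r(N)/48, and h >= 1. *)
rewrite cE ler_expR lerN2 !natrM.
have : 1 <= h%:R :> R by rewrite ler1n.
have : 0 <= (mrank I [set: T])%:R :> R by [].
nra.
Qed.
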